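(* Let $H$ be a connected rooted graph on $h\ge 1$ vertices with root $o$, let $G$ be any graph, and let $\Delta\ge 0$ be a real number. Let $\hom_{\Delta}(H,G)$ be the number of homomorphisms $\varphi:H\to G$ such that $d_{\varphi(o)}\ge\Delta$, where $d_v$ denotes the degree of a vertex $v$ in $G$. Then $$\hom_{\Delta}(H,G)\le\sum_{v\in V(G)} d_v^{\,h-1}\,\mathbf 1_{\{d_v\ge\Delta\}}.$$
   Context: Graphs are finite and simple (undirected, without loops or multiple edges). A homomorphism $H\to G$ is a map $V(H)\to V(G)$ sending adjacent vertices to adjacent vertices. A rooted graph is a graph with a distinguished vertex, its root. $\mathbf 1_{\{\cdot\}}$ is the indicator. Convention: $0^0=1$. *)

(* Defs.v *)
From mathcomp Require Import all_boot all_order all_algebra.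
From mathcomp Require Export reals.

Set Implicit Arguments.
Unset Strict Implicit.
Unset Printing Implicit Defensive.

Import Order.TTheory GRing.Theory Num.Theory.

Record sgraph := SGraph {
  vertex :> finType;
  adj : rel vertex;
  adj_sym : symmetric adj;
  adj_irrefl : irreflexive adj
}.

Definition degree (G : sgraph) (v : G) : nat := #|[set w : G | adj v w]|.

(* The empty graph is connected under this definition; a rooted graph is never
   empty. *)
Definition connected_graph (G : sgraph) : Prop :=
  forall x y : G, connect (@adj G) x y.

Definition is_hom (H G : sgraph) (f : {ffun H -> G}) : bool :=
  [forall x : H, forall y : H, adj x y ==> adj (f x) (f y)].

Definition hom_ge (R : realType) (H : sgraph) (o : H) (G : sgraph)
    (Delta : R) : nat :=
  #|[set f : {ffun H -> G} | is_hom f & (Delta <= (degree (f o))%:R)%R]|.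

(* Main.v *)
(** Grow a spanning tree of [H] from [o], one edge (new vertex, parent) at a
    time; a homomorphism from [H] is in particular one from the tree.  Give a
    tree homomorphism [f] the weight [d(f o) / prod d(f p)], over the parents
    [p] of all edges: this is the tree-indexed simple random walk started from
    the measure [d], which is stationary, so every [f z] is distributed as [d]
    (up to lost mass).  As [o] is a parent, counting homomorphisms amounts to
    integrating against this measure a product of [h - 2] degrees [d(f p)] and
    the indicator of [d(f o) >= Delta].  Writing each degree as a sum of
    threshold indicators, and because thresholds are nested, such an integral is
    at most its value when all the [f z] coincide. *)
Require Import Defs.
From mathcomp Require Import all_boot all_order all_algebra reals.
From mathcomp Require Import ring.

Set Implicit Arguments.
Unset Strict Implicit.
Unset Printing Implicit Defensive.

Import Order.TTheory GRing.Theory Num.Theory.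

Lemma sum_ltn_andb (R : pzSemiRingType) (M n : nat) (b : bool) : n <= M ->
  (\sum_(t < M) ((t < n)%N && b)%:R = n%:R * b%:R :> R)%R.
Proof.
move=> le_nM; rewrite -natr_sum -natrM; congr (_%:R)%R.
under eq_bigr => t _ do rewrite -mulnb.
rewrite -big_distrl -big_mkcond /= -(big_ord_widen M (fun=> 1%N)) //.
by rewrite sum1_card card_ord.
Qed.

Definition nat_upset (P : pred nat) : Prop :=
  forall m n, m <= n -> P m -> P n.

Section Comonotone.
Local Open Scope ring_scope.

Variables (T I : Type) (V : finType) (X : seq T) (m : T -> rat).
Variables (a : I -> T -> nat) (c : V -> rat) (d : V -> nat) (M : nat).
Hypothesis m_ge0 : forall f, 0 <= m f.
Hypothesis a_le : forall i f, (a i f <= M)%N.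
Hypothesis d_le : forall v, (d v <= M)%N.
Hypothesis marginal : forall (i : I) (P : pred nat), nat_upset P ->
  \sum_(f <- X) m f * (P (a i f))%:R <= \sum_v c v * (P (d v))%:R.

(** Layer-cake induction on [q]: the factor [a j f] is split into the indicators of [t < a j f]. For
    each [t], this indicator and that of [P (a i f)] are absorbed into the single up-set [Q t] at
    one index, while on the [V] side the same split is exact. *)
Lemma comonotone_prod_le (q : seq I) (i : I) (P : pred nat) : nat_upset P ->
  \sum_(f <- X) m f * (\prod_(j <- q) a j f)%:R * (P (a i f))%:R
    <= \sum_v c v * (d v ^ size q)%:R * (P (d v))%:R.
Proof.
elim: q i P => [|j q IHq] i P upP.
  under eq_bigr => f _ do rewrite big_nil mulr1.
  under [leRHS]eq_bigr => v _ do rewrite expn0 mulr1.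
  exact: marginal.
pose Q (t : nat) : pred nat := fun n => (t < n)%N && P n.
have upQ t : nat_upset (Q t).
  by move=> k n le_kn /andP[tk Pk]; rewrite /Q (leq_trans tk le_kn) (upP k).
have -> : \sum_(v : V) c v * (d v ^ size (j :: q))%:R * (P (d v))%:R
    = \sum_(t < M) \sum_(v : V) c v * (d v ^ size q)%:R * (Q t (d v))%:R.
  rewrite exchange_big; apply: eq_bigr => v _ /=.
  by rewrite -mulr_sumr sum_ltn_andb // expnS natrM; ring.
have -> : \sum_(f <- X) m f * (\prod_(k <- j :: q) a k f)%:R * (P (a i f))%:R
    = \sum_(t < M) \sum_(f <- X) m f * (\prod_(k <- q) a k f)%:R
        * ((t < a j f)%N && P (a i f))%:R.
  rewrite exchange_big; apply: eq_bigr => f _ /=.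
  by rewrite -mulr_sumr sum_ltn_andb // big_cons natrM; ring.
apply: ler_sum => t _.
(* [k] is the index carrying the smaller of the two nested up-sets. *)
suff [k kP] : exists k, forall f, (t < a j f)%N && P (a i f) -> Q t (a k f).
  apply: le_trans (IHq k (Q t) (upQ t)); apply: ler_sum => f _.
  apply: ler_wpM2l; first by rewrite mulr_ge0.
  by rewrite ler_nat; case: (_ && _) (kP f) => // ->.
(* [P t.+1] decides which up-set is contained in the other: if it holds, [t < n] implies [P n];
   otherwise [P n] implies [t < n]. *)
case Pt: (P t.+1).
  by exists j => f /andP[tj _]; rewrite /Q tj (upP t.+1).
exists i => f /andP[_ Pi]; rewrite /Q Pi andbT ltnNge; apply/negP => le_it.
by rewrite (upP (a i f)) // leqW in Pt.
Qed.

End Comonotone.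

Section TreeGrowth.

Variables (H : sgraph) (o : H).

(* [(x, p)] attaches the new vertex [x] to the existing vertex [p]; the most
   recent edge comes first. *)
Fixpoint grown (L : seq (H * H)) : bool :=
  if L is (x, p) :: L' then
    [&& x \notin o :: unzip1 L', p \in o :: unzip1 L', adj p x & grown L']
  else true.

Lemma grown_uniq L : grown L -> uniq (o :: unzip1 L).
Proof.
elim: L => [|[x p] L IHL] //= /and4P[xL _ _ /IHL /= /andP[oL uL]].
by move: xL; rewrite !inE !negb_or eq_sym oL uL => /andP[-> ->].
Qed.

Lemma grown_parents L : grown L -> {subset unzip2 L <= o :: unzip1 L}.
Proof.
elim: L => [|[x p] L IHL] //= /and4P[_ pL _ gL] y.
have sub z : z \in o :: unzip1 L -> z \in [:: o, x & unzip1 L].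
  by rewrite !inE => /orP[->|->]; rewrite ?orbT.
by rewrite inE => /orP[/eqP->|/(IHL gL)]; apply: sub.
Qed.

(** The oldest edge can only attach to [o], the sole vertex present at that time. *)
Lemma grown_root_parent L : grown L -> L != [::] -> o \in unzip2 L.
Proof.
elim: L => [|[x p] [|e L] IHL] //.
  by rewrite /= !inE => /and4P[_ /eqP-> _ _].
by case/and4P=> _ _ _ /IHL /(_ isT) oL _; rewrite inE oL orbT.
Qed.

Lemma exists_grown : connected_graph H ->
  exists L, [/\ grown L, size L = #|H|.-1 & forall x, x \in o :: unzip1 L].
Proof.
move=> H_conn.
have grow k : k < #|H| -> exists2 L, grown L & size L = k.
  elim: k => [|k IHk] ltk; first by exists [::].
  have [L gL sL] := IHk (ltnW ltk).
  pose A := o :: unzip1 L.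
  case: (boolP [exists p, [exists x, [&& p \in A, x \notin A & adj p x]]]).
    case/existsP=> p /existsP[x /and3P[pA xA px]].
    by exists ((x, p) :: L); rewrite /= ?sL // xA pA px.
  move=> noedge.
  (* With no edge leaving [A], connectedness forces [A] to be all of [H], contradicting
     [k < #|H|]. *)
  have clA : closed (@adj H) (mem A).
    apply: intro_closed; first by apply: sym_connect_sym; apply: adj_sym.
    move=> p x px pA; apply: contraR noedge => xA.
    by apply/existsP; exists p; apply/existsP; exists x; rewrite px andbT; apply/andP.
  have allA x : x \in A.
    by have /= <- := closed_connect clA (H_conn o x); exact: mem_head.
  have /card_uniqP := grown_uniq gL; rewrite -/A /= size_map sL => cA.
  by move: ltk; rewrite -cA (eq_card allA) ltnn.
have H_gt0 : 0 < #|H| by apply/card_gt0P; exists o.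
have [|L gL sL] := grow #|H|.-1; first by rewrite prednK.
exists L; split=> // x.
have cA : #|o :: unzip1 L| = #|H|.
  by have /card_uniqP -> := grown_uniq gL; rewrite /= size_map sL prednK.
have /subset_cardP/(_ (subset_predT _)) -> // := cA.
Qed.

Variable G : sgraph.

Definition update (f : {ffun H -> G}) (x : H) (w : G) : {ffun H -> G} :=
  [ffun z => if z == x then w else f z].

(* Maps on the whole of [H]; vertices outside the tree are sent where [o] is. *)
Fixpoint tree_homs (L : seq (H * H)) : seq {ffun H -> G} :=
  if L is (x, p) :: L' then
    [seq update f x w | f <- tree_homs L', w <- enum [pred w | adj (f p) w]]
  else [seq [ffun=> v] | v <- enum G].

(** The default value [f o] off the tree matches the constant maps that start [tree_homs]; once the
    tree spans [H], the modified map is [f] itself. *)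
Lemma hom_in_tree_homs L (f : {ffun H -> G}) : grown L -> is_hom f ->
  [ffun z => if z \in unzip1 L then f z else f o] \in tree_homs L.
Proof.
move=> + /forallP hf; elim: L => [|[x p] L IHL] /=.
  by move=> _; apply/mapP; exists (f o); rewrite ?mem_enum //; apply/ffunP=> z; rewrite !ffunE.
case/and4P=> xL pL px /IHL gL.
set g := [ffun z => _] in gL.
have gp : g p = f p.
  by rewrite ffunE; case: ifP => // npL; move: pL; rewrite inE npL orbF => /eqP->.
apply/allpairsPdep; exists g, (f x); split=> //.
  by rewrite mem_enum inE gp; have /forallP/(_ x)/implyP := hf p; apply.
by apply/ffunP=> z; rewrite !ffunE inE; case: eqP => //= ->.
Qed.

(** The image of a child is a neighbour of the image of its parent. This makes the denominator of
    [walk_weight] nonzero. *)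
Lemma tree_homs_parent L (f : {ffun H -> G}) p : grown L ->
  f \in tree_homs L -> p \in unzip2 L -> 0 < degree (f p).
Proof.
elim: L f p => [|[x q] L IHL] f p //= /and4P[xL qL qx gL].
case/allpairsPdep=> [g [w [gL' gw ->]]] pL.
have px : p != x.
  apply: contraNneq xL => <-.
  by move: pL; rewrite inE => /orP[/eqP->|/(grown_parents gL)].
rewrite ffunE (negPf px); move: pL; rewrite inE => /orP[/eqP->|]; last exact: IHL.
by apply/card_gt0P; exists w; move: gw; rewrite mem_enum !inE.
Qed.

Lemma hom_ge_le_tree_homs (R : realType) (Delta : R) L : grown L ->
  (forall x, x \in o :: unzip1 L) ->
  hom_ge o G Delta
    <= \sum_(f <- tree_homs L) (Delta <= (degree (f o))%:R)%R.
Proof.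
move=> gL allL; rewrite /hom_ge -big_mkcond sum1_count -size_filter cardE.
apply: uniq_leq_size; first exact: enum_uniq.
move=> f; rewrite mem_enum inE mem_filter => /andP[hf ->] /=.
have := hom_in_tree_homs gL hf.
rewrite (_ : finfun _ = f) //; apply/ffunP=> z; rewrite ffunE.
by case: ifP => // zL; have := allL z; rewrite inE zL orbF => /eqP->.
Qed.

Section WalkWeight.
Local Open Scope ring_scope.

Definition walk_weight (L : seq (H * H)) (f : {ffun H -> G}) : rat :=
  (degree (f o))%:R / (\prod_(p <- unzip2 L) degree (f p))%:R.

Lemma walk_weight_ge0 L f : 0 <= walk_weight L f.
Proof. by rewrite divr_ge0. Qed.

Lemma walk_weight_update x p L f w : grown ((x, p) :: L) ->
  walk_weight ((x, p) :: L) (update f x w) = walk_weight L f / (degree (f p))%:R.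
Proof.
move=> /= /and4P[xL pL _ gL].
have upd q : q \in o :: unzip1 L -> update f x w q = f q.
  by move=> qL; rewrite ffunE; case: eqP xL => // <-; rewrite qL.
rewrite /walk_weight /= big_cons !upd ?mem_head // natrM invfM mulrA mulrAC.
congr (_ / _%:R / _); apply: eq_big_seq => q qL.
by rewrite upd // (grown_parents gL).
Qed.

(** Induction removing the newest leaf [x]: if [z] is [x], one walk step moves the test function to
    the parent; otherwise summing out the leaf cannot increase the mass. *)
Lemma walk_marginal L z (g : G -> rat) : grown L -> (forall v, 0 <= g v) ->
  \sum_(f <- tree_homs L) walk_weight L f * g (f z)
    <= \sum_v (degree v)%:R * g v.
Proof.
move=> + g_ge0; elim: L z g g_ge0 => [|[x p] L IHL] z g g_ge0.
  move=> _; rewrite big_map big_enum /=; apply: ler_sum => v _.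
  by rewrite /walk_weight big_nil divr1 !ffunE.
move=> gL; have /= /and4P[_ _ _ gL'] := gL.
rewrite big_allpairs_dep /=.
under eq_bigr => f _ do under eq_bigr => w _ do
  rewrite (walk_weight_update _ _ gL) ffunE.
have [zx|zx] := eqVneq z x.
  (* The walk's transition operator applied to [g]; symmetry of [adj] makes the degree measure
     stationary for it. *)
  pose Pg (u : G) := \sum_(w | adj u w) g w / (degree u)%:R.
  have Pg_ge0 u : 0 <= Pg u by apply: sumr_ge0 => w _; rewrite divr_ge0.
  have := IHL p Pg Pg_ge0 gL'.
  have -> : \sum_v (degree v)%:R * Pg v = \sum_v (degree v)%:R * g v.
    transitivity (\sum_v \sum_(w | adj v w) g w).
      apply: eq_bigr => v _; rewrite mulr_sumr; apply: eq_bigr => w vw.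
      rewrite mulrC divfK // pnatr_eq0 -lt0n.
      by apply/card_gt0P; exists w; rewrite ?inE.
    rewrite (exchange_big_dep predT) //=; apply: eq_bigr => w _.
    rewrite sumr_const mulr_natl; congr (_ *+ _).
    by rewrite /degree cardsE; apply: eq_card => v; exact: adj_sym.
  apply: le_trans; rewrite le_eqVlt; apply/orP; left; apply/eqP.
  apply: eq_bigr => f _; rewrite big_enum mulr_sumr /=.
  by apply: eq_bigr => w _; rewrite -mulrA [_^-1 * _]mulrC.
apply: le_trans (IHL z g g_ge0 gL'); apply: ler_sum => f _.
rewrite big_enum sumr_const /=.
have -> : #|[pred w | adj (f p) w]| = degree (f p) by rewrite /degree cardsE.
have := walk_weight_ge0 L f; move: (walk_weight L f) => W W_ge0.
rewrite -[leLHS]mulr_natr; set D := (degree _)%:R.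
have -> : W / D * g (f z) * D = W * g (f z) * (D^-1 * D) by ring.
rewrite ler_piMr ?mulr_ge0 //.
(* Mass is lost exactly at [D = 0], where the parent's image has no neighbour to step to. *)
by have [->|D0] := eqVneq D 0; rewrite ?mulr0 // mulVf.
Qed.

End WalkWeight.

End TreeGrowth.

Theorem theorem2 (R : realType) (H : sgraph) (o : H) (h : nat)
    (h_ge1 : 1 <= h) (card_H : #|H| = h) (H_conn : connected_graph H)
    (G : sgraph) (Delta : R) (Delta_ge0 : (0 <= Delta)%R) :
  hom_ge o G Delta <=
    \sum_(v : G) degree v ^ (h - 1) * (Delta <= (degree v)%:R)%R.
Proof.
have [L [gL sL allL]] := exists_grown o H_conn.
apply: leq_trans (hom_ge_le_tree_homs G Delta gL allL) _.
have [L0|Ln0] := eqVneq L [::].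
  (* Here [h = 1], and isolated vertices count through [0 ^ 0 = 1]. *)
  rewrite L0 /= in sL *; rewrite subn1 -card_H -sL big_map big_enum /=.
  by apply: leq_sum => v _; rewrite ffunE expn0 mul1n.
have oL := grown_root_parent gL Ln0.
(* One occurrence of [o] cancels the numerator of [walk_weight], so weight times the product over
   [q] is 1. The [h - 2] degrees left and the one from the measure give the exponent [h - 1]. *)
pose q := rem o (unzip2 L).
have sq : (h - 1 = (size q).+1)%N.
  rewrite size_rem // size_map prednK ?lt0n ?size_eq0 //.
  by rewrite sL card_H subn1.
pose P : pred nat := fun n => (Delta <= n%:R)%R.
have upP : nat_upset P.
  by move=> m n le_mn /le_trans; apply; rewrite ler_nat.
have deg_le (v : G) : degree v <= #|G| by apply: max_card.
have := @comonotone_prod_le _ _ _ (tree_homs G L) (walk_weight o L)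
  (fun p f => degree (f p)) (fun v : G => (degree v)%:R%R) (@degree G) #|G|
  (walk_weight_ge0 o L) (fun _ _ => deg_le _) deg_le
  (fun i Q _ => walk_marginal i gL (fun v => ler0n _ (Q (degree v)))) q o P upP.
rewrite -(ler_nat rat) !natr_sum; congr (_ <= _)%R; last first.
  by apply: eq_bigr => v _; rewrite sq expnS !natrM.
apply: eq_big_seq => f fL; rewrite -[RHS]mul1r; congr (_ * _)%R.
have := tree_homs_parent gL fL; rewrite /walk_weight => d_gt0.
rewrite (perm_big _ (perm_to_rem oL)) big_cons natrM.
rewrite mulrAC divff // mulf_neq0 // pnatr_eq0 -lt0n ?d_gt0 //.
by rewrite big_seq prodn_cond_gt0 // => p /mem_rem /d_gt0.
Qed.
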